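(* Let $N$ be an LG number, with $N>10^{(10^{13})}$. Then $N$ is colossally abundant.
   Context: $\log$ is the natural logarithm, $\gamma$ is the Euler–Mascheroni constant, $\sigma(n)=\sum_{d\mid n}d$, $\rho(n)=\sigma(n)/n$, and $G(n)=\rho(n)/\log\log n$. A counterexample to the Robin hypothesis is an integer $n>5040$ with $G(n)\ge e^{\gamma}$. An LG (largest $G$-value) number is a counterexample $N>5040$ at which $G$ attains its largest value among counterexamples; equivalently, $N>5040$, $G(N)\ge e^\gamma$, and $G(m)\le G(N)$ for all integers $m>5040$. (Existence of LG numbers is not asserted.) A positive integer $N$ is colossally abundant if there is $\epsilon>0$ such that $\sigma(m)/m^{1+\epsilon}\le \sigma(N)/N^{1+\epsilon}$ for all integers $m\ge 1$. *)

(* Defs.v *)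
From mathcomp Require Import all_boot all_order all_algebra.
From mathcomp Require Import all_classical all_reals all_analysis.
Set Implicit Arguments.
Unset Strict Implicit.
Unset Printing Implicit Defensive.
Import Order.TTheory GRing.Theory Num.Theory.
Import numFieldNormedType.Exports.
Local Open Scope classical_set_scope.
Local Open Scope ring_scope.

(* [series harmonic n] is H_n = 1 + 1/2 + ... + 1/n. *)
Definition euler_gamma (R : realType) : R :=
  limn (fun n : nat => series harmonic n - ln (n%:R : R)).

Definition sigma (n : nat) : nat := (\sum_(d <- divisors n) d)%N.

Definition rho (R : realType) (n : nat) : R := (sigma n)%:R / n%:R.

Definition G (R : realType) (n : nat) : R := rho R n / ln (ln n%:R).

Definition robin_counterexample (R : realType) (n : nat) : Prop :=
  (5040 < n)%N /\ expR (euler_gamma R) <= G R n.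

Definition LG (R : realType) (N : nat) : Prop :=
  robin_counterexample R N /\
  forall m : nat, robin_counterexample R m -> G R m <= G R N.

Definition colossally_abundant (R : realType) (N : nat) : Prop :=
  (0 < N)%N /\
  exists eps : R, 0 < eps /\
    forall m : nat, (1 <= m)%N ->
      (sigma m)%:R / m%:R `^ (1 + eps) <= (sigma N)%:R / N%:R `^ (1 + eps).

(* Main.v *)
Require Import Defs.
From mathcomp Require Import all_boot all_order all_algebra.
From mathcomp Require Import all_classical all_reals all_analysis.
From mathcomp Require Import zify ring lra.

(** Write [f m = ln (ln m)].  Since [G R N] is maximal, [rho R m] is at most
    [G R N * f m] for every [m] above 5040, with equality at [N].  In the
    variable [t = ln m], the function [ln (ln t)] is concave; taking exponentials
    of its tangent inequality at [T = ln N], whose slope is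
    [eps = 1 / (T * ln T)], gives [ln t <= ln T * expR (eps * (t - T))]
    ([ln_le_tangent]).  Hence [rho R m / m ^ eps <= rho R N / N ^ eps] for those
    [m], which is the colossally abundant inequality with parameter [eps].

    The maximality of [G R N] says nothing about [m <= 5040]; there a crude size
    comparison is enough.  On one side [rho R m <= 1 + ln m <= 1 + 4 * ln 10]
    ([rho_le_1Dln]).  On the other, with [L = ln T], the number [N ^ eps] is
    [expR (1 / L)], so [rho R N / N ^ eps] is at least [G R N * (L - 1)], while
    [L >= 13 * ln 10] by the size of [N] ([ln_ln_ge]).  All that is asked of
    [G R N] is a constant lower bound, and comparing with one explicit integer
    above 5040 gives [1 / 2] ([half_le_G5046]). *)

Import Order.TTheory GRing.Theory Num.Theory.
Local Open Scope ring_scope.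

(** The involution [d |-> n %/ d] of the divisors turns [d / n] into [1 / d]. *)
Lemma rho_sum_invr (R : realType) (n : nat) : (0 < n)%N ->
  rho R n = \sum_(d <- divisors n) d%:R^-1.
Proof.
move=> n_gt0.
have codivP d : d \in divisors n -> (n %/ d)%N \in divisors n /\ (n %/ (n %/ d))%N = d.
  rewrite -!dvdn_divisors // => dn.
  by rewrite dvdn_div // divnA // mulKn.
have codiv_perm : perm_eq (divisors n) [seq (n %/ d)%N | d <- divisors n].
  apply: uniq_perm; first exact: divisors_uniq.
    rewrite map_inj_in_uniq ?divisors_uniq // => d e /codivP[_ dK] /codivP[_ eK] de.
    by rewrite -dK de eK.
  move=> d; apply/idP/mapP => [/codivP[nd dK]|[e /codivP[ne _] ->//]].
  by exists (n %/ d)%N.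
rewrite /rho /sigma natr_sum (perm_big _ codiv_perm)/= big_map mulr_suml.
apply: eq_big_seq => d; rewrite -dvdn_divisors // => dn.
have d_gt0 : (0 < d)%N := dvdn_gt0 n_gt0 dn.
have d0 : (d%:R : R) != 0 by rewrite pnatr_eq0 -lt0n.
have n0 : (n%:R : R) != 0 by rewrite pnatr_eq0 -lt0n.
by rewrite natr_div ?unitfE // mulrAC mulfV // mul1r.
Qed.

Lemma ln_le_sub1 (R : realType) (x : R) : 0 < x -> ln x <= x - 1.
Proof.
move=> x0; have -> : ln x = ln (1 + (x - 1)) by congr ln; lra.
by apply: le_ln1Dx; lra.
Qed.

(** Inductive step: [ln x <= x - 1] at [x = (n + 1) / (n + 2)] bounds the new
    term [1 / (n + 2)] by the increment of the logarithm. *)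
Lemma harmonic_sum_le (R : realType) (n : nat) :
  \sum_(1 <= d < n.+2) d%:R^-1 <= 1 + ln (n.+1%:R : R).
Proof.
elim: n => [|n IHn]; first by rewrite big_nat1 invr1 ln1 addr0.
rewrite big_nat_recr //=.
have a0 : 0 < n.+1%:R :> R by rewrite ltr0n.
have b0 : 0 < n.+2%:R :> R by rewrite ltr0n.
have := @ln_le_sub1 R (n.+1%:R / n.+2%:R) (divr_gt0 a0 b0).
rewrite ln_div ?posrE //.
have -> : n.+1%:R / n.+2%:R - 1 = - n.+2%:R^-1 :> R.
  by rewrite -[in n.+1%:R](addrK 1 n.+1%:R) natr1 mulrBl divff ?gt_eqF //; ring.
move: (ln _) (ln _) (_^-1) (\sum_(1 <= d < n.+2) _) IHn => a b c s; lra.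
Qed.

(** The divisors of [n] are among [1, ..., n], so [rho R n] is bounded by the
    [n]-th harmonic number. *)
Lemma rho_le_1Dln (R : realType) (n : nat) : (0 < n)%N ->
  rho R n <= 1 + ln n%:R.
Proof.
move=> n_gt0; rewrite rho_sum_invr //.
case: n n_gt0 => // n _; apply: le_trans (harmonic_sum_le R n).
have -> : \sum_(d <- divisors n.+1) d%:R^-1
    = \sum_(1 <= d < n.+2 | (d %| n.+1)%N) (d%:R^-1 : R).
  rewrite -[RHS]big_filter; apply: perm_big.
  apply: uniq_perm; rewrite ?divisors_uniq ?filter_uniq ?iota_uniq // => d.
  rewrite mem_filter -dvdn_divisors // mem_index_iota.
  have [dn|//] := boolP (d %| n.+1)%N.
  by rewrite (dvdn_gt0 _ dn) // ltnS dvdn_leq.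
rewrite big_mkcond /=; apply: ler_sum => d _.
by case: ifP => // _; rewrite invr_ge0.
Qed.

(** The quantity maximized by a colossally abundant number, in the exponential
    form in which it can be compared with the tangent inequality. *)
Lemma sigma_powR (R : realType) (n : nat) (eps : R) : (0 < n)%N ->
  (sigma n)%:R / n%:R `^ (1 + eps) = rho R n * expR (- (eps * ln n%:R)).
Proof.
move=> n_gt0; have n0 : (n%:R : R) != 0 by rewrite pnatr_eq0 -lt0n.
rewrite powRD ?n0 ?implybT // powRr1 // [n%:R `^ eps]/powR (negbTE n0).
by rewrite expRN invfM mulrA.
Qed.

(** The exponential of the tangent inequality at [T] for [ln (ln t)].  Going
    through [ln t <= ln T + (t / T - 1)] and [1 + u <= expR u] instead of
    concavity covers also [t <= 1], where [ln (ln t)] has no meaning. *)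
Lemma ln_le_tangent (R : realType) (t T : R) : 0 < t -> 1 < T ->
  ln t <= ln T * expR ((t - T) / (T * ln T)).
Proof.
move=> t0 T1; have T0 : 0 < T by lra.
have L0 : 0 < ln T by rewrite ln_gt0.
have := @ln_le_sub1 R (t / T) (divr_gt0 t0 T0).
rewrite ln_div ?posrE // => le1.
apply: (@le_trans _ _ (ln T * (1 + (t - T) / (T * ln T)))).
  suff -> : ln T * (1 + (t - T) / (T * ln T)) = ln T + (t / T - 1) by lra.
  by field; rewrite !gt_eqF.
by rewrite ler_pM2l // expR_ge1Dx.
Qed.

Lemma ln10_ge1 (R : realType) : 1 <= ln 10 :> R.
Proof.
(* [1 / 2 <= expR (- 1 / 2)] gives [expR 1 <= 4] after inverting and squaring. *)
rewrite -[leLHS](expRK 1) ler_ln ?posrE ?expR_gt0 //.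
have h := @expR_ge1Dx R (- 2^-1).
have -> : 1 = 2^-1 + 2^-1 :> R by field.
rewrite expRD.
have E : expR (- 2^-1) * expR (2^-1) = 1 :> R by rewrite -expRD addNr expR0.
have := @expR_gt0 R (2^-1).
nra.
Qed.

Lemma ln_nat_gt1 (R : realType) (n : nat) : (10 < n)%N -> 1 < ln (n%:R : R).
Proof.
move=> n10; apply: le_lt_trans (ln10_ge1 R) _.
by rewrite ltr_ln ?posrE ?ltr0n ?ltr_nat //; lia.
Qed.

Lemma ln_ln_gt0 (R : realType) (n : nat) : (10 < n)%N -> 0 < ln (ln (n%:R : R)).
Proof. by move=> n10; apply/ln_gt0/ln_nat_gt1. Qed.

(** An [m] that is not a counterexample has [G R m] below Robin's constant, and
    [G R N] is at least that constant; so maximality among the counterexamples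
    is maximality among all integers above 5040. *)
Lemma LG_max (R : realType) (N m : nat) : LG R N -> (5040 < m)%N ->
  G R m <= G R N.
Proof.
move=> [[_ robinN] maxN] m_gt.
have [robin_m|/ltW le_m] := leP (expR (euler_gamma R)) (G R m); first exact: maxN.
exact: le_trans robinN.
Qed.

(** 5046 is the first multiple of 6 above 5040: its divisor sum ratio is
    at least [1 + 1/2 + 1/3 + 1/6 = 2], and [5046 <= 2 ^ 13], [13 <= 2 ^ 4] with [ln 2 <= 1]
    bound its iterated logarithm by 4. *)
Lemma half_le_G5046 (R : realType) : 2^-1 <= G R 5046.
Proof.
have ln2 : ln 2 <= 1 :> R by have := @ln_le_sub1 R 2 ltac:(lra); lra.
have ln_le k n : (0 < n <= 2 ^ k)%N -> ln (n%:R : R) <= k%:R.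
  move=> /andP[n_gt0 n_le]; apply: (@le_trans _ _ (ln (2 ^+ k))).
    by rewrite ler_ln ?posrE ?exprn_gt0 ?ltr0n // -natrX ler_nat.
  by rewrite lnXn // -[leRHS]mulr1 mulr_natl lerMn2r ln2 orbT.
have l1 : ln (5046%:R : R) <= 13%:R by apply: ln_le; vm_compute.
have l0 := @ln_nat_gt1 R 5046 isT.
have l2 : ln (ln (5046%:R : R)) <= 4.
  apply: le_trans (ln_le 4%N 13%N isT).
  by rewrite ler_ln ?posrE //; lra.
have l3 := @ln_ln_gt0 R 5046 isT.
have r2 : 2 <= rho R 5046.
  rewrite /rho ler_pdivlMr ?ltr0n // -natrM ler_nat /sigma -sumnE.
  by vm_compute.
by rewrite /G ler_pdivlMr //; lra.
Qed.

Lemma ln_ln_ge (R : realType) (k N : nat) : (10 ^ (10 ^ k) < N)%N ->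
  ln 10 *+ k <= ln (ln (N%:R : R)).
Proof.
move=> N_gt; have l10 := ln10_ge1 R.
have ten k' : 0 < 10 ^+ k' :> R by rewrite exprn_gt0.
rewrite -lnXn // ler_ln ?posrE //; last first.
  apply/ln_gt0; rewrite ltr1n.
  by apply: leq_ltn_trans N_gt; rewrite expn_gt0.
apply: (@le_trans _ _ (ln (10 ^+ (10 ^ k)))).
  rewrite lnXn // -[leRHS]mulr_natr natrX.
  by rewrite -[leLHS]mul1r ler_wpM2r // ltW.
rewrite ler_ln ?posrE // ?ltr0n -?natrX ?ler_nat ?(ltnW N_gt) //.
exact: leq_ltn_trans N_gt.
Qed.

Theorem theorem1 (R : realType) (N : nat) :
  LG R N -> (10 ^ (10 ^ 13) < N)%N -> colossally_abundant R N.
Proof.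
move=> lgN /(@ln_ln_ge R 13 N) L_ge; have N_gt5040 : (5040 < N)%N by case: lgN => -[].
have lnN1 : 1 < ln (N%:R : R) by apply: ln_nat_gt1; exact: ltn_trans N_gt5040.
have l10 := ln10_ge1 R.
set T := ln (N%:R : R) in lnN1 L_ge *.
set L := ln T in L_ge.
have L0 : 0 < L by exact: ln_gt0.
have GN : 2^-1 <= G R N.
  exact: le_trans (half_le_G5046 R) (@LG_max R N 5046 lgN isT).
have rhoN : rho R N = G R N * L by rewrite /G divfK // gt_eqF.
have N_gt0 : (0 < N)%N by exact: leq_ltn_trans N_gt5040.
split=> //; exists (T * L)^-1; split; first by rewrite invr_gt0 mulr_gt0 //; lra.
move=> m m_gt0; rewrite !sigma_powR //.
set eps := (T * L)^-1; rewrite -/T.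
have [m_le|m_gt] := leqP m 5040.
  apply: (@le_trans _ _ (1 + ln 10 *+ 4)).
    apply: (@le_trans _ _ (rho R m)).
      rewrite -[leRHS]mulr1 ler_wpM2l ?divr_ge0 // expR_le1 oppr_le0.
      by rewrite mulr_ge0 ?ln_ge0 ?ler1n // invr_ge0 mulr_ge0 //; lra.
    apply: le_trans (@rho_le_1Dln R m m_gt0) _.
    rewrite lerD2l -lnXn // ler_ln ?posrE ?ltr0n ?exprn_gt0 //.
    rewrite -natrX ler_nat; exact: leq_trans m_le _.
  have epsT : eps * T = L^-1 by rewrite /eps; field; rewrite !gt_eqF //; lra.
  rewrite epsT rhoN.
  have : L - 1 <= L * expR (- L^-1).
    have -> : L - 1 = L * (1 - L^-1) by field; rewrite gt_eqF.
    by rewrite ler_pM2l // expR_ge1Dx.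
  (* From [G R N >= 1/2] and [L >= 13 * ln 10] it remains that
     [1 + 4 * ln 10 <= (13 * ln 10 - 1) / 2], which holds as [ln 10 >= 1]. *)
  rewrite -mulrA; nra.
have m10 : (10 < m)%N by exact: ltn_trans m_gt.
have rhom : rho R m <= G R N * ln (ln m%:R).
  by rewrite -ler_pdivrMr ?ln_ln_gt0 //; exact: LG_max.
rewrite rhoN.
have lnm0 : 0 < ln (m%:R : R) by have := @ln_nat_gt1 R m m10; lra.
have := ln_le_tangent _ _ _ lnm0 lnN1; rewrite -/L => tang.
rewrite expRN ler_pdivrMr ?expR_gt0 // -[leRHS]mulrA -expRD.
have -> : - (eps * T) + eps * ln m%:R = (ln m%:R - T) / (T * L).
  by rewrite /eps; ring.
apply: le_trans rhom _.
by rewrite -[leRHS]mulrA; apply: ler_wpM2l => //; lra.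
Qed.
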